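(* Let $F$ be a finite poset with $|F|>1$ such that (i) $F$ has at least two minimal elements, and (ii) every maximal element of $F$ has a lower cover (in $F$) which is not a minimal element of $F$. Then $\chi_{ac}(F)=2$.
   Context: All posets are finite. A poset $P$ is $F$-free if $P$ contains no subposet isomorphic to $F$. A subset $S$ of a poset $P$ (with the induced order) is maximal $F$-free if $S$ is $F$-free but every subset of $P$ strictly containing $S$ contains a subposet isomorphic to $F$. For a finite poset $F$ with $|F|>1$, $\chi_{ac}(F)$ is the smallest integer $n$ (if it exists) such that for every finite poset $P$ with $|P|>1$, the elements of $P$ can be coloured with at most $n$ colours so that every maximal $F$-free subset of $P$ with more than one element receives at least two colours. A lower cover of an element $x$ is an element $y<x$ such that there is no $z$ with $y<z<x$. *)

(* Defs.v *)
From mathcomp Require Import all_boot all_order.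
Set Implicit Arguments.
Unset Strict Implicit.
Unset Printing Implicit Defensive.
Local Open Scope order_scope.

Definition minimal (d : Order.disp_t) (P : finPOrderType d) (x : P) : bool :=
  [forall y : P, ~~ (y < x)].

Definition maximal (d : Order.disp_t) (P : finPOrderType d) (x : P) : bool :=
  [forall y : P, ~~ (x < y)].

Definition lower_cover (d : Order.disp_t) (P : finPOrderType d) (y x : P)
    : bool :=
  (y < x) && ~~ [exists z : P, (y < z) && (z < x)].

Section MaximalFree.
Variables (dF : Order.disp_t) (F : finPOrderType dF).

(* Subposets carry the induced order, so a copy of F is given by a map that
   both preserves and reflects <= (and hence is injective, by antisymmetry). *)
Definition contains_copy (d : Order.disp_t) (P : finPOrderType d)
    (S : {set P}) : Prop :=
  exists f : F -> P,
    {mono f : x y / x <= y} /\ (forall x : F, f x \in S).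

Definition maximal_free (d : Order.disp_t) (P : finPOrderType d)
    (S : {set P}) : Prop :=
  ~ contains_copy S /\ (forall T : {set P}, S \proper T -> contains_copy T).

Definition ac_colourable (n : nat) : Prop :=
  forall (d : Order.disp_t) (P : finPOrderType d), (1 < #|P|)%N ->
    exists c : P -> 'I_n,
      forall S : {set P}, maximal_free S -> (1 < #|S|)%N ->
        exists x y : P, [/\ x \in S, y \in S & c x != c y].

(* chi_ac need not be defined for every F, so it is given by its graph. *)
Definition is_chi_ac (n : nat) : Prop :=
  ac_colourable n /\ (forall m : nat, ac_colourable m -> (n <= m)%N).

End MaximalFree.

Arguments contains_copy {dF} F {d P} S.
Arguments maximal_free {dF} F {d P} S.
Arguments ac_colourable {dF} F n.
Arguments is_chi_ac {dF} F n.

(* Main.v *)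
Require Import Defs.
From mathcomp Require Import all_boot all_order.

(** Condition (ii) says that every maximal element of [F] is the top of a
3-chain.  Unless [P] is an antichain, pick [z] in [P] which is not minimal but
has only minimal elements below it, and colour [x] according to whether
[z <= x].  A maximal [F]-free [S] disjoint from the up-set of [z] would give a
copy of [F] in [z |: S] with [z] maximal, hence a 3-chain with top [z].  If
instead [S] lies in the up-set of [z], pick [p < z]: adding [p] to [S] would
give a copy of [F] with least element [p], but [F] has two minimal elements. *)

Set Implicit Arguments.
Unset Strict Implicit.
Unset Printing Implicit Defensive.

Import Order.TTheory.
Local Open Scope order_scope.

Section FinPOrder.
Variables (d : Order.disp_t) (P : finPOrderType d).

Lemma minimalP (x : P) : reflect (forall y : P, ~~ (y < x)) (minimal x).
Proof. exact: forallP. Qed.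

Lemma maximalP (x : P) : reflect (forall y : P, ~~ (x < y)) (maximal x).
Proof. exact: forallP. Qed.

Lemma nminimalP (x : P) : reflect (exists y : P, y < x) (~~ minimal x).
Proof.
rewrite negb_forall; apply: (iffP existsP) => -[y].
  by rewrite negbK; exists y.
by exists y; rewrite negbK.
Qed.

(** Take [z] in [Q] with the fewest elements strictly below it: any [y < z] has a strictly smaller
    strict down-set, since that of [z] also contains [y]. *)
Lemma exists_minimal_in (Q : pred P) (x0 : P) :
  Q x0 -> exists2 z, Q z & forall y, y < z -> ~~ Q y.
Proof.
move=> Qx0.
case: (arg_minnP (fun x : P => #|[set y | y < x]|) Qx0) => z Qz zmin.
exists z => // y ltyz; apply/negP => /zmin; apply/negP; rewrite -ltnNge.
apply: proper_card; apply/properP; split; last first.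
  by exists y; rewrite !inE ?ltxx.
by apply/subsetP => w; rewrite !inE => /lt_trans; apply.
Qed.

End FinPOrder.

Lemma exists_maximal (d : Order.disp_t) (P : finPOrderType d) (x0 : P) :
  exists x : P, maximal x.
Proof.
(* A maximal element is a minimal one for the dual order. *)
have [//|z _ zmax] := @exists_minimal_in _ P^d xpredT x0.
by exists z; apply/maximalP => y; apply/negP => /zmax.
Qed.

Section MaximalFree.
Variables (dF : Order.disp_t) (F : finPOrderType dF).
Variables (d : Order.disp_t) (P : finPOrderType d).

(** Maximality yields a copy of [F] in [z |: S]; it must pass through [z], or it would lie in the
    [F]-free set [S]. *)
Lemma maximal_free_copy (S : {set P}) (z : P) :
    maximal_free F S -> z \notin S ->
  exists f : F -> P,
    [/\ {mono f : x y / x <= y}, forall x, f x \in z |: S & exists a, f a = z].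
Proof.
move=> [Sfree Smax] zS.
have [|f [fM fS]] := Smax (z |: S).
  rewrite properE subsetUr; apply/subsetPn; exists z => //.
  by rewrite in_setU1 eqxx.
exists f; split=> //.
have [/existsP[a /eqP fa]|/existsPn nz] := boolP [exists a, f a == z].
  by exists a.
case: Sfree; exists f; split=> // x.
by have := fS x; rewrite in_setU1 (negPf (nz x)).
Qed.

End MaximalFree.

Section TwoColours.
Variables (dF : Order.disp_t) (F : finPOrderType dF).
Hypothesis two_minimal : (1 < #|[set x : F | minimal x]|)%N.
Hypothesis max_cover : forall x : F, maximal x ->
  exists y : F, lower_cover y x /\ ~~ minimal y.

Lemma maximal_chain3 (x : F) : maximal x -> exists c y : F, c < y /\ y < x.
Proof.
by move=> /max_cover[y [/andP[ltyx _] /nminimalP[c ltcy]]]; exists c, y.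
Qed.

Lemma exists_chain3 : exists c y x : F, c < y /\ y < x.
Proof.
have /card_gt0P[x0 _] := ltnW two_minimal.
have [x /maximal_chain3[c [y H]]] := exists_maximal x0.
by exists c, y, x.
Qed.

(** A least element would be the only minimal one. *)
Lemma no_least (a : F) : ~ (forall y : F, a <= y).
Proof.
move=> aleast.
have mina x : minimal x -> x = a.
  move=> /minimalP/(_ a); rewrite lt_neqAle aleast andbT negbK => /eqP.
  exact: esym.
have /card_gt1P[x [y []]] := two_minimal.
by rewrite !inE => /mina-> /mina->; rewrite eqxx.
Qed.

Section Poset.
Variables (d : Order.disp_t) (P : finPOrderType d).

(** An antichain has no room for the 3-chain found in every copy of [F]. *)
Lemma antichain_maximal_free (S : {set P}) :
  (forall x : P, minimal x) -> maximal_free F S -> S = [set: P].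
Proof.
move=> Pmin Smax; apply/setP => z; rewrite in_setT.
apply/negPn/negP => /(maximal_free_copy Smax)[f [fM _ _]].
have [c [y [_ [ltcy _]]]] := exists_chain3.
by have /minimalP/(_ (f c)) := Pmin (f y); rewrite (leW_mono fM) ltcy.
Qed.

Lemma maximal_free_meets_upset (S : {set P}) (z : P) :
    (forall y, y < z -> minimal y) -> maximal_free F S ->
  exists2 x, x \in S & z <= x.
Proof.
move=> zmin Smax.
have [/exists_inP[x xS lezx]|/exists_inPn nz] :=
  boolP [exists x in S, z <= x].
  by exists x.
have zS : z \notin S by apply/negP => /nz; rewrite lexx.
have [f [fM fS [a fa]]] := maximal_free_copy Smax zS.
(* If [a < b], then [f b] differs from [z], so it is a point of [S] above [z], which is excluded. *)
have /maximal_chain3[c [y [ltcy ltya]]] : maximal a.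
  apply/maximalP => b; apply/negP => ltab.
  have ltzb : z < f b by rewrite -fa (leW_mono fM).
  have := fS b; rewrite in_setU1 gt_eqF //= => /nz.
  by rewrite (ltW ltzb).
have /zmin/minimalP/(_ (f c)) : f y < z by rewrite -fa (leW_mono fM).
by rewrite (leW_mono fM) ltcy.
Qed.

Lemma maximal_free_not_in_upset (S : {set P}) (z : P) :
    ~~ minimal z -> maximal_free F S -> exists2 x, x \in S & ~~ (z <= x).
Proof.
move=> /nminimalP[p ltpz] Smax.
have [/exists_inP[x xS lezx]|/exists_inPn Sz] :=
  boolP [exists x in S, ~~ (z <= x)].
  by exists x.
have {}Sz x : x \in S -> z <= x by move/Sz; rewrite negbK.
have pS : p \notin S by apply/negP => /Sz; rewrite lt_geF.
have [f [fM fS [a fa]]] := maximal_free_copy Smax pS.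
(* Every point of the copy other than [p] lies in [S], hence above [z] and so above [p]. *)
case: (@no_least a) => y; rewrite -fM fa.
have := fS y; rewrite in_setU1 => /predU1P[->//|/Sz].
by apply: le_trans; apply: ltW.
Qed.

End Poset.

Lemma ac_colourable2 : ac_colourable F 2.
Proof.
move=> d P /card_gt1P[u [v [_ _ neq_uv]]].
have bi (Q : pred P) (S : {set P}) x y : x \in S -> y \in S -> Q x -> ~~ Q y ->
    exists x y, [/\ x \in S, y \in S &
      (if Q x then ord0 else ord_max : 'I_2) != if Q y then ord0 else ord_max].
  by move=> xS yS Qx /negPf nQy; exists x, y; rewrite Qx nQy.
have [/existsP[w wmin]|/existsPn Pmin] := boolP [exists w : P, ~~ minimal w].
  have [z zN zmin] := exists_minimal_in (Q := fun x : P => ~~ minimal x) wmin.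
  exists (fun x => if z <= x then ord0 else ord_max) => S Smax _.
  have [|x xS lezx] := maximal_free_meets_upset (S := S) (z := z) _ Smax.
    by move=> y /zmin; rewrite negbK.
  have [y yS nlezy] := maximal_free_not_in_upset zN Smax.
  exact: (bi (fun x => z <= x) S x y).
(* Here [P] is an antichain and [S] is all of [P], so it suffices to separate [u] from [v]. *)
exists (fun x => if x == u then ord0 else ord_max) => S Smax _.
rewrite (antichain_maximal_free _ Smax) => [|x]; last first.
  by have := Pmin x; rewrite negbK.
by apply: (bi (pred1 u) _ u v); rewrite ?in_setT //= eq_sym.
Qed.

(** The two-element chain [bool] contains no 3-chain, so it is a maximal [F]-free subset of itself,
    and fewer than two colours cannot split it. *)
Lemma ac_colourable_ge2 (m : nat) : ac_colourable F m -> (2 <= m)%N.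
Proof.
move=> colm; rewrite leqNgt; apply/negP => m_lt2.
have [|c cP] := colm _ bool; first by rewrite card_bool.
have [||x [y [_ _ /eqP[]]]] := cP [set: bool]; last 2 first.
- by rewrite cardsT card_bool.
- apply: val_inj => /=.
  have c0 b : c b = 0 :> nat.
    by apply/eqP; rewrite -leqn0 -ltnS; apply: leq_trans (ltn_ord _) _.
  by rewrite !c0.
split=> [[f [fM _]]|T]; last by rewrite properE subsetT andbF.
have [a [b [e [ltab ltbe]]]] := exists_chain3.
move: ltab ltbe; rewrite -!(leW_mono fM).
by case: (f a) (f b) (f e) => [] [] [].
Qed.

End TwoColours.

Local Close Scope order_scope.

Theorem theorem3 (dF : Order.disp_t) (F : finPOrderType dF)
    (F_gt1 : 1 < #|F|)
    (two_minimal : 1 < #|[set x : F | minimal x]|)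
    (max_cover : forall x : F, maximal x ->
       exists y : F, lower_cover y x /\ ~~ minimal y) :
  is_chi_ac F 2.
Proof.
by split; [exact: ac_colourable2 | move=> m; exact: ac_colourable_ge2].
Qed.
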